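(* Let $(X,f)$ be a dynamical system (with nonempty compact Hausdorff phase space). The relation $\preceq$ on the class of objects $\mathrm{Ob}\,\mathfrak B_0'(X,f)$ is a partial order, and the following statements hold: (i) each element $(h,(A,g))\in\mathrm{Ob}\,\mathfrak B_0'(X,f)$ is majorized (with respect to $\preceq$) by some element $(h',(A',g'))\in\mathrm{Ob}\,\mathfrak B_0'(X,f)$ such that $\Phi(\mathcal P(A',g'))=\Phi(\mathcal P(X,f))$; (ii) an element $(h,(A,g))\in\mathrm{Ob}\,\mathfrak B_0'(X,f)$ is maximal with respect to $\preceq$ if and only if $\Phi(\mathcal P(A,g))=\Phi(\mathcal P(X,f))$.
   Context: Here $\mathbb N=\{1,2,\dots\}$. A dynamical system is a pair $(X,f)$ with $X$ a nonempty compact Hausdorff space and $f:X\to X$ a homeomorphism. A morphism $h:(X,f)\to(Y,g)$ is a continuous map $h:X\to Y$ with $h\circ f=g\circ h$; the category so obtained is $\mathcal K_0$. Topologically conjugate means isomorphic in $\mathcal K_0$. A periodic partition of $(X,f)$ of length $m\in\mathbb N$ is a family $\{W_i\}_{i=0}^{m-1}$ of pairwise disjoint open-closed subsets of $X$ with union $X$, such that $f(W_{i-1})=W_i$ for $i=1,\dots,m-1$ and $f(W_{m-1})=W_0$. $\mathcal P(X,f)\subseteq\mathbb N$ is the set of lengths of all periodic partitions of $(X,f)$. An ultranatural number is a family $N=(N_p)_p$ indexed by primes $p$ with $N_p\in\{0,1,2,\dots\}\cup\{\infty\}$; the set $\Sigma$ of these is ordered by $M\le N$ iff $M_p\le N_p$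 for all $p$. For nonempty $S\subseteq\mathbb N$, $\Phi(S)\in\Sigma$ is defined by $\Phi(S)_p=\sup\{k\ge 0: p^k \text{ divides some } a\in S\}$. An odometer: given a sequence $\{n_i\}_{i\in\mathbb N}$ of positive integers with $n_i\mid n_{i+1}$ (bounded sequences allowed), $A=\varprojlim \mathbb Z/n_i\mathbb Z$ (inverse limit of discrete cyclic groups along the maps $1\mapsto 1$, with the inverse limit topology) and $g(\vec a)=\vec a+\vec e$, $\vec e=(1,1,\dots)$; $(A,g)$ is the odometer constructed on $\{n_i\}$. $\mathcal A$ is the full subcategory of $\mathcal K_0$ whose objects are the dynamical systems topologically conjugate to odometers; $\mathcal A(X,f)$ is the full subcategory of $\mathcal A$ of objects $(A,g)$ with $\Phi(\mathcal P(A,g))\le\Phi(\mathcal P(X,f))$. A skeleton of a category is a full subcategory containing exactly one representative of each isomorphism class of objects. $\mathcal A_0(X,f)$ is a fixed skeleton of $\mathcal A(X,f)$. The category $\mathfrak B(X,f)$: objects are pairs $(h,(A,g))$ with $(A,g)$ an object of $\mathcal A(X,f)$ and $h:(X,f)\to(A,g)$ a morphism; morphisms from $(h_1,(A_1,g_1))$ to $(h_2,(A_2,g_2))$ are the (triples given by) morphisms $\pi:(A_1,g_1)\to(A_2,g_2)$ with $h_2=\pi\circ h_1$. $\mathfrak B'(X,f)$ is the full subcategory of $\mathfrak B(X,f)$ of objects $(h,(A,g))$ with $(A,g)\in\mathrm{Ob}\,\mathcal A_0(X,f)$, and $\mathfrak B_0'(X,f)$ is a fixed skeleton of $\mathfrak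 B'(X,f)$. For objects of $\mathfrak B_0'(X,f)$, $(h_1,(A_1,g_1))\preceq(h_2,(A_2,g_2))$ means that there exists a morphism in $\mathfrak B(X,f)$ from $(h_2,(A_2,g_2))$ to $(h_1,(A_1,g_1))$. *)

(* Defs.v *)
From HB Require Import structures.
From Stdlib Require Relation_Definitions.
From mathcomp Require Import all_boot all_order all_algebra.
From mathcomp Require Import all_classical all_reals topology.

Set Implicit Arguments.
Unset Strict Implicit.
Unset Printing Implicit Defensive.

Local Open Scope classical_set_scope.

Record category := Category {
  obj :> Type;
  hom : obj -> obj -> Type;
  idm : forall x, hom x x;
  compm : forall x y z, hom y z -> hom x y -> hom x z;
  compm_idl : forall x y (u : hom x y), compm (idm y) u = u;
  compm_idr : forall x y (u : hom x y), compm u (idm x) = u;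
  compm_assoc : forall x y z t (u : hom z t) (v : hom y z) (w : hom x y),
    compm u (compm v w) = compm (compm u v) w }.

Definition isomorphic (C : category) (x y : C) : Prop :=
  exists (u : hom x y) (v : hom y x), compm v u = idm x /\ compm u v = idm y.

Definition full_sub (C : category) (P : C -> Prop) : category :=
  @Category {x : C | P x} (fun x y => hom (sval x) (sval y))
    (fun x => idm (sval x)) (fun x y z u v => compm u v)
    (fun x y => @compm_idl C (sval x) (sval y))
    (fun x y => @compm_idr C (sval x) (sval y))
    (fun x y z t => @compm_assoc C (sval x) (sval y) (sval z) (sval t)).

(* The full subcategory of [C] on the objects satisfying [S] is a skeleton. *)
Definition skeleton (C : category) (S : C -> Prop) : Prop :=
  forall x : C, exists! y : C, S y /\ isomorphic x y.

(* The choice operator carried by the [topologicalType] structure is not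
   mathematical content: morphisms, hence isomorphisms, ignore it. *)
Record dynsys := Dynsys {
  space :> topologicalType;
  dmap : space -> space;
  dynsys_nonempty : [set: space] !=set0;
  dynsys_compact : compact [set: space];
  dynsys_hausdorff : hausdorff_space space;
  dynsys_continuous : continuous dmap;
  dynsys_homeo : exists dinv : space -> space,
    [/\ continuous dinv, cancel dmap dinv & cancel dinv dmap] }.

Record morphism (X Y : dynsys) := Morphism {
  morph_fun :> X -> Y;
  morph_continuous : continuous morph_fun;
  morph_equivariant : morph_fun \o @dmap X = @dmap Y \o morph_fun }.

Lemma morphism_eq (X Y : dynsys) (h k : morphism X Y) :
  h = k :> (X -> Y) -> h = k.
Proof.
case: h k => [h hc he] [k kc ke] /= hk; case: _ / hk kc ke => kc ke.
by rewrite (Prop_irrelevance hc kc) (Prop_irrelevance he ke).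
Qed.

Definition morph_id (X : dynsys) : morphism X X :=
  @Morphism X X id (fun=> @cvg_id _ _) erefl.

Lemma morph_comp_continuous (X Y Z : dynsys)
  (k : morphism Y Z) (h : morphism X Y) : continuous (k \o h).
Proof.
move=> x; apply: continuous_comp; [exact: morph_continuous|].
exact: morph_continuous.
Qed.

Lemma morph_comp_equivariant (X Y Z : dynsys)
  (k : morphism Y Z) (h : morphism X Y) :
  (k \o h) \o @dmap X = @dmap Z \o (k \o h).
Proof.
by rewrite -compA morph_equivariant compA morph_equivariant.
Qed.

Definition morph_comp (X Y Z : dynsys)
    (k : morphism Y Z) (h : morphism X Y) : morphism X Z :=
  Morphism (@morph_comp_continuous X Y Z k h) (morph_comp_equivariant k h).

Lemma morph_comp_idl (X Y : dynsys) (h : morphism X Y) :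
  morph_comp (morph_id Y) h = h.
Proof. exact: morphism_eq. Qed.

Lemma morph_comp_idr (X Y : dynsys) (h : morphism X Y) :
  morph_comp h (morph_id X) = h.
Proof. exact: morphism_eq. Qed.

Lemma morph_compA (X Y Z T : dynsys)
  (u : morphism Z T) (v : morphism Y Z) (w : morphism X Y) :
  morph_comp u (morph_comp v w) = morph_comp (morph_comp u v) w.
Proof. exact: morphism_eq. Qed.

Definition K0 : category :=
  Category morph_comp_idl morph_comp_idr morph_compA.

Definition periodic_partition (X : dynsys) (m : nat) (W : nat -> set X) : Prop :=
  [/\ trivIset `I_m W,
      \bigcup_(i < m) W i = [set: X],
      forall i, (i < m)%N -> clopen (W i),
      forall i, (0 < i < m)%N -> @dmap X @` W i.-1 = W i
    & @dmap X @` W m.-1 = W 0%N].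

Definition periods (X : dynsys) : set nat :=
  [set m | (0 < m)%N /\ exists W, @periodic_partition X m W].

(* [None] stands for infinity. *)
Definition enat := option nat.

Definition enat_le (a b : enat) : Prop :=
  match a, b with
  | _, None => True
  | None, Some _ => False
  | Some i, Some j => (i <= j)%N
  end.

Definition enat_sup (K : set nat) : enat :=
  if `[< has_ubound K >] then Some (supremum 0%N K) else None.

Definition ultranatural := {p : nat | prime p} -> enat.

Definition ultra_le (M N : ultranatural) : Prop := forall p, enat_le (M p) (N p).

Definition Phi (S : set nat) : ultranatural :=
  fun p => enat_sup [set k | exists2 a, S a & (sval p ^ k %| a)%N].

Record divseq := Divseq {
  dseq :> nat -> nat;
  dseq_gt0 : forall i, (0 < dseq i)%N;
  dseq_dvd : forall i, (dseq i %| dseq i.+1)%N }.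

(* The discrete cyclic group Z/n for n > 0; the form n.-1.+1 gives access to
   the group structure of ordinals, including for n = 1, where 'Z_1 would be
   Z/2. *)
Definition cyc (n : nat) : discreteTopologicalType :=
  discrete_topology 'I_n.-1.+1.

Definition cyc_add (n : nat) (a b : cyc n) : cyc n :=
  ((a : 'I_n.-1.+1) + (b : 'I_n.-1.+1))%R.

(* Reduction modulo n, which is the group morphism 1 |-> 1 when n divides m. *)
Definition cyc_red (m n : nat) (a : cyc m) : cyc n :=
  inZp (nat_of_ord (a : 'I_m.-1.+1)).

Lemma cyc_redD (m n : nat) (a b : cyc m) : (0 < m)%N -> (n %| m)%N ->
  cyc_red n (cyc_add a b) = cyc_add (cyc_red n a) (cyc_red n b).
Proof.
move=> m0 nm; have n0 : (0 < n)%N by apply: dvdn_gt0 nm.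
apply: val_inj => /=; rewrite modnDm modn_dvdm //.
by rewrite !prednK.
Qed.

Section InverseLimit.
Variable n : divseq.

Definition invlim : set (prod_topology (fun i => cyc (n i))) :=
  [set a | forall i, cyc_red (n i) (a i.+1) = a i].

Definition odo_space : topologicalType := set_type invlim.

Definition odo_coord (a : odo_space) (i : nat) : cyc (n i) := set_val a i.

Lemma odo_coord_red (a : odo_space) i :
  cyc_red (n i) (odo_coord a i.+1) = odo_coord a i.
Proof. exact: (set_mem (proj2_sig a) : invlim _). Qed.

Definition odo_mk (a : forall i, cyc (n i))
    (ha : forall i, cyc_red (n i) (a i.+1) = a i) : odo_space :=
  exist _ (a : prod_topology (fun i => cyc (n i))) (mem_set (ha : invlim a)).

Lemma odo_eq (a b : odo_space) :
  (forall i, odo_coord a i = odo_coord b i) -> a = b.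
Proof.
move=> ab; apply: val_inj; apply: functional_extensionality_dep => i.
exact: ab.
Qed.

Lemma odo_add_subproof (a b : odo_space) i :
  cyc_red (n i) (cyc_add (odo_coord a i.+1) (odo_coord b i.+1)) =
  cyc_add (odo_coord a i) (odo_coord b i).
Proof.
by rewrite cyc_redD ?dseq_gt0 ?dseq_dvd // !odo_coord_red.
Qed.

Definition odo_add (a b : odo_space) : odo_space :=
  odo_mk (odo_add_subproof a b).

Lemma odo_one_subproof i : cyc_red (n i) (Zp1 : cyc (n i.+1)) = Zp1.
Proof.
apply: val_inj => /=; rewrite modn_dvdm //.
by rewrite !prednK ?dseq_gt0 ?dseq_dvd.
Qed.

Definition odo_one : odo_space := odo_mk odo_one_subproof.

Definition odo_map (a : odo_space) : odo_space := odo_add a odo_one.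

Lemma odo_opp_subproof (a : odo_space) i :
  cyc_red (n i) ((- (odo_coord a i.+1 : 'I_(n i.+1).-1.+1))%R : cyc (n i.+1)) =
  (- (odo_coord a i : 'I_(n i).-1.+1))%R.
Proof.
apply: (@GRing.addIr _ (odo_coord a i : 'I_(n i).-1.+1)).
rewrite GRing.addNr -[in X in (_ + X)%R](odo_coord_red a i).
have := cyc_redD ((- (odo_coord a i.+1 : 'I_(n i.+1).-1.+1))%R : cyc (n i.+1))
  (odo_coord a i.+1) (dseq_gt0 n i.+1) (dseq_dvd n i).
rewrite /cyc_add GRing.addNr => <-.
by apply: val_inj => /=; rewrite mod0n.
Qed.

Definition odo_opp (a : odo_space) : odo_space := odo_mk (odo_opp_subproof a).

Lemma odo_mapK : cancel odo_map (fun a => odo_add a (odo_opp odo_one)).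
Proof. by move=> a; apply: odo_eq => i; exact: GRing.addrK. Qed.

Lemma odo_mapVK : cancel (fun a => odo_add a (odo_opp odo_one)) odo_map.
Proof. by move=> a; apply: odo_eq => i; exact: GRing.subrK. Qed.

Lemma odo_coord_continuous i : continuous (fun a => odo_coord a i).
Proof.
move=> a; apply: (@continuous_comp _ _ _
  (set_val : odo_space -> prod_topology (fun i => cyc (n i))) (proj i)).
  exact: initial_continuous.
exact: proj_continuous.
Qed.

Lemma odo_continuous (T : topologicalType) (f : T -> odo_space) :
  (forall i, continuous (fun x => odo_coord (f x) i)) -> continuous f.
Proof.
move=> cf; apply: continuous_comp_initial => x; apply/cvg_sup => i.
move: x; apply/(@continuousP _ (initial_topology (@^~ i))) => A [B oB <-].
by move/continuousP: (cf i); apply.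
Qed.

Lemma odo_addr_continuous (b : odo_space) : continuous (odo_add^~ b).
Proof.
apply: odo_continuous => i a.
apply: (@continuous_comp _ _ _ (fun a => odo_coord a i)
  (fun c => cyc_add c (odo_coord b i))).
  exact: odo_coord_continuous.
by move: (odo_coord a i); apply/continuousP => A _; exact: discrete_open.
Qed.

Lemma odo_hausdorff : hausdorff_space odo_space.
Proof.
move=> a b ab; apply: odo_eq => i; apply: (@discrete_hausdorff (cyc (n i))).
move=> A B nA nB.
have [c [Ac Bc]] := ab _ _ (odo_coord_continuous nA) (odo_coord_continuous nB).
by exists (odo_coord c i).
Qed.

Lemma invlim_closed : closed invlim.
Proof.
have -> : invlim = \bigcap_i \bigcap_(c in [set: cyc (n i)])
    ((proj i @^-1` (~` [set c])) `|`
     (proj i.+1 @^-1` (cyc_red (n i) @^-1` [set c]))).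
  apply/seteqP; split => [a ha i _ c _|a ha i].
    by have [ac|ac] := EM (a i = c); [right; rewrite /= -ac; exact: ha|left].
  by case: (ha i I (a i) I) => [/(_ erefl)|].
apply: closed_bigI => i _; apply: closed_bigI => c _.
apply: closedU.
  apply: preimage_closed; last exact: discrete_closed.
  by move=> a _; exact: proj_continuous.
apply: preimage_closed; last exact: discrete_closed.
by move=> a _; exact: proj_continuous.
Qed.

Lemma invlim_compact : compact invlim.
Proof.
apply: (subclosed_compact invlim_closed
  (@tychonoff _ (fun i => cyc (n i)) (fun=> setT) _)) => //.
by move=> i; apply: finite_compact; exact: (@finite_finset 'I_(n i).-1.+1).
Qed.

Lemma odo_compact : compact [set: odo_space].
Proof.
move=> F FF _.
have GA : (set_val @ F) invlim.
  by apply: (@filterS _ F FF setT) => [a _|]; [exact: set_valP|exact: filterT].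
have [x [Ax clx]] := invlim_compact _ GA.
exists (odo_mk Ax); split => // B U FB [_ [[W oW <-] /= Wx WU]].
have FWB : (set_val @ F) (set_val @` B).
  by apply: (@filterS _ F FF B) => // b Bb; exists b.
have [_ [[b Bb <-] Wb]] := clx _ _ FWB (open_nbhs_nbhs (conj oW Wx)).
by exists b; split => //; exact: WU.
Qed.

End InverseLimit.

Lemma odo_homeo (n : divseq) : exists dinv : odo_space n -> odo_space n,
  [/\ continuous dinv, cancel (@odo_map n) dinv & cancel dinv (@odo_map n)].
Proof.
exists (fun a => odo_add a (odo_opp (odo_one n))).
split; [exact: odo_addr_continuous|exact: odo_mapK|exact: odo_mapVK].
Qed.

Definition odometer (n : divseq) : dynsys :=
  @Dynsys (odo_space n) (@odo_map n)
    (ex_intro _ (odo_one n) I) (@odo_compact n) (@odo_hausdorff n)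
    (@odo_addr_continuous n (odo_one n)) (odo_homeo n).

Definition catA : category :=
  @full_sub K0 (fun D => exists n, @isomorphic K0 D (odometer n)).

Section CategoryB.
Variable X : dynsys.

Definition catAX : category :=
  @full_sub catA (fun D => ultra_le (Phi (periods (sval D))) (Phi (periods X))).

Definition system (D : catAX) : dynsys := sval (sval D).

Record objB := ObjB {
  targetB : catAX;
  mapB : morphism X (system targetB) }.

Record homB (o1 o2 : objB) := HomB {
  homB_fun :> @hom catAX (targetB o1) (targetB o2);
  homB_comm : mapB o2 = morph_comp homB_fun (mapB o1) }.

Lemma homB_eq (o1 o2 : objB) (u v : homB o1 o2) :
  homB_fun u = homB_fun v -> u = v.
Proof.
case: u v => [u hu] [v hv] /= uv; case: _ / uv hv => hv.
by rewrite (Prop_irrelevance hu hv).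
Qed.

Lemma homB_id_subproof (o : objB) :
  mapB o = morph_comp (idm (targetB o)) (mapB o).
Proof. by rewrite morph_comp_idl. Qed.

Definition homB_id (o : objB) : homB o o := HomB (homB_id_subproof o).

Lemma homB_comp_subproof (o1 o2 o3 : objB) (v : homB o2 o3) (u : homB o1 o2) :
  mapB o3 = morph_comp (compm (homB_fun v) (homB_fun u)) (mapB o1).
Proof. by rewrite (homB_comm v) (homB_comm u) morph_compA. Qed.

Definition homB_comp (o1 o2 o3 : objB) (v : homB o2 o3) (u : homB o1 o2) :
  homB o1 o3 := HomB (homB_comp_subproof v u).

Lemma homB_comp_idl (o1 o2 : objB) (u : homB o1 o2) :
  homB_comp (homB_id o2) u = u.
Proof. by apply: homB_eq; exact: morph_comp_idl. Qed.

Lemma homB_comp_idr (o1 o2 : objB) (u : homB o1 o2) :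
  homB_comp u (homB_id o1) = u.
Proof. by apply: homB_eq; exact: morph_comp_idr. Qed.

Lemma homB_compA (o1 o2 o3 o4 : objB)
  (u : homB o3 o4) (v : homB o2 o3) (w : homB o1 o2) :
  homB_comp u (homB_comp v w) = homB_comp (homB_comp u v) w.
Proof. by apply: homB_eq; exact: morph_compA. Qed.

Definition catB : category := Category homB_comp_idl homB_comp_idr homB_compA.

Variable A0 : catAX -> Prop.

Definition catB' : category := @full_sub catB (fun o => A0 (targetB o)).

Variable B0' : catB' -> Prop.

Definition catB0' : category := full_sub B0'.

Definition underlyingB (o : catB0') : catB := sval (sval o).

Definition phase (o : catB0') : dynsys := system (targetB (underlyingB o)).

Definition preceq (o1 o2 : catB0') : Prop :=
  inhabited (hom (underlyingB o2) (underlyingB o1)).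

Definition maximal (o : catB0') : Prop :=
  forall o' : catB0', preceq o o' -> o' = o.

End CategoryB.

(* Main.v *)
Require Import Defs.
From Stdlib Require Relation_Definitions.
From mathcomp Require Import all_boot all_order zmodp all_classical topology.

(** Everything is expressed through clocks modulo m: locally constant functions
    phi with phi (f x) = phi x + 1 mod m. A periodic partition of length m is
    the same thing as a clock modulo m ([periodsP]), and a morphism into an
    odometer is the same thing as a compatible family of clocks
    ([odo_factor]).

    Two clocks modulo n differ by an f-invariant locally constant function, and
    such a function lifts from Z/n to Z/m without any compatibility condition.
    Hence a clock modulo n can be refined to any other period of the system:
    given clocks modulo a and b, the second is corrected so as to agree with the
    first modulo gcd(a, b), and the Chinese remainder theorem then glues both
    into a clock modulo lcm(a, b) that refines the first ([clock_extend]). In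
    particular the set of periods is closed under least common multiples.

    Majorants. Let h : X -> A be a morphism to the odometer of (n_j), and let
    L_k be the lcm of the periods of X up to k. Since gcd(n_j, L_k) is
    eventually constant in j, there are indices J(k) from which on it no longer
    changes. For M_k = lcm(n_(J k), L_k) this gives
    gcd(M_k, n_(J (k+1))) = n_(J k), so that a clock modulo M_k refining the
    clock n_(J k) of h is automatically compatible with the clock n_(J (k+1)).
    Refining step by step yields a morphism from X to the odometer of (M_k)
    through which h factors; as every period of X divides some M_k, this
    odometer has the same ultranatural number as X ([odometer_enlarge]).

    Antisymmetry. Odometers are minimal, so every morphism of a system into one
    is surjective ([morphism_odometer_surj]); two objects with arrows in both
    directions are therefore isomorphic, hence equal in a skeleton.

    Maximality. A maximal object equals the majorant just constructed.
    Conversely suppose that A has the ultranatural number of X and that p is an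
    arrow from A' to A. The moduli n'_i of A' are periods of A, by comparing
    prime powers ([Phi_dvd]). A clock of A modulo n'_i, pulled back to A' along
    p, differs from the i-th coordinate of A' by an invariant locally constant
    function, which is a constant by minimality. Corrected by these
    constants, the clocks of A form a left inverse of p ([odo_retraction]), an
    arrow in the other direction. *)

Set Implicit Arguments.
Unset Strict Implicit.
Unset Printing Implicit Defensive.

Local Open Scope classical_set_scope.
Local Open Scope nat_scope.

(** * Congruences *)

Lemma eq_mod_dvd d m a b : d %| m -> a = b %[mod m] -> a = b %[mod d].
Proof. by move=> dm ab; rewrite -(modn_dvdm a dm) ab modn_dvdm. Qed.

Lemma eq_modD m a b c d :
  a = b %[mod m] -> c = d %[mod m] -> a + c = b + d %[mod m].
Proof. by move=> ab cd; rewrite -modnDm ab cd modnDm. Qed.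

Lemma modn_prednK m x : 0 < m -> x %% m.-1.+1 = x %% m.
Proof. by move/prednK->. Qed.

Lemma eq_mod_lcm a b x y :
  x = y %[mod a] -> x = y %[mod b] -> x = y %[mod lcmn a b].
Proof.
wlog yx : x y / y <= x => [th xya xyb|].
  by case/orP: (leq_total x y) => h; [symmetry|]; apply: th.
move=> /eqP xya /eqP xyb; apply/eqP; move: xya xyb.
by rewrite !eqn_mod_dvd // dvdn_lcm => -> ->.
Qed.

(** A common solution of z = x mod a and z = y mod b for moduli that need not be
    coprime: a Bezout multiple of a equal to gcd(a, b) mod b is used (y - x) /
    gcd(a, b) times. Replacing y by y + b * x, which is congruent to it mod b,
    keeps the truncated subtraction exact. *)
Definition chinese_lcm a b x y :=
  x + (egcdn a b).1 * a * ((y + b * x - x) %/ gcdn a b).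

Lemma chinese_lcmP a b x y : 0 < a -> 0 < b -> x = y %[mod gcdn a b] ->
  chinese_lcm a b x y = x %[mod a] /\ chinese_lcm a b x y = y %[mod b].
Proof.
move=> a0 b0 xy; rewrite /chinese_lcm; case: egcdnP => // u v uv _ /=.
set g := gcdn a b; split.
  by rewrite mulnAC addnC modnMDl.
have gt : g * ((y + b * x - x) %/ g) = y + b * x - x.
  rewrite mulnC divnK // -eqn_mod_dvd; last first.
    by rewrite (leq_trans (leq_pmull x b0)) ?leq_addl.
  apply/eqP; rewrite xy.
  apply: (@eq_mod_dvd _ b); first exact: dvdn_gcdr.
  by rewrite addnC mulnC modnMDl.
rewrite uv -/g mulnDl gt mulnAC addnCA modnMDl subnKC.
  by rewrite addnC mulnC modnMDl.
by rewrite (leq_trans (leq_pmull x b0)) ?leq_addl.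
Qed.

(** Distributivity and absorption in the divisibility lattice; this makes the
    consecutive steps of the enlargement of an odometer compatible. *)
Lemma gcdn_lcm_stable a b l : a %| b -> gcdn b l = gcdn a l ->
  gcdn (lcmn a l) b = a.
Proof.
move=> ab bl; rewrite (Order.NatDvd.meetUl a l b).
by rewrite (gcdn_idPl ab) (gcdnC l b) bl; exact: Order.NatDvd.meetKU.
Qed.

(** The residue of a - b modulo n. *)
Definition defect n (a b : nat) := (a + (n - b %% n)) %% n.

Lemma defectP n a b : 0 < n -> b + defect n a b = a %[mod n].
Proof.
move=> n0; rewrite modnDmr addnCA -modnDmr -(modnDml b).
by rewrite subnKC ?modnn ?addn0 // ltnW ?ltn_mod.
Qed.

Lemma defect_uniq n a b c : 0 < n -> c < n -> b + c = a %[mod n] ->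
  c = defect n a b.
Proof.
move=> n0 cn bca; have := etrans bca (esym (defectP a b n0)) => /eqP.
by rewrite eqn_modDl !modn_small ?ltn_mod // => /eqP.
Qed.

(** * Clocks *)

Definition locally_constant (T : topologicalType) (phi : T -> nat) :=
  forall x, \forall y \near x, phi y = phi x.

(** Values are natural numbers read modulo m, so that one function can serve for
    several moduli and refining a clock needs no change of type. *)
Definition clock (X : dynsys) (m : nat) (phi : X -> nat) :=
  locally_constant phi /\ forall x, phi (dmap x) = (phi x).+1 %[mod m].

Lemma locally_constant2 (T : topologicalType) (g : nat -> nat -> nat)
    (phi psi : T -> nat) : locally_constant phi -> locally_constant psi ->
  locally_constant (fun x => g (phi x) (psi x)).
Proof.
by move=> cphi cpsi x; near=> y; congr g; near: y; [exact: cphi|exact: cpsi].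
Unshelve. all: by end_near. Qed.

Lemma clock_dvd (X : dynsys) d m (phi : X -> nat) :
  d %| m -> clock m phi -> clock d phi.
Proof. by move=> dm [cphi ephi]; split=> // x; exact: eq_mod_dvd (ephi x). Qed.

Lemma clock_comp (X Y : dynsys) (h : morphism X Y) m (phi : Y -> nat) :
  clock m phi -> clock m (phi \o h).
Proof.
move=> [cphi ephi]; split=> [x|x /=].
  exact: (morph_continuous (cphi (h x))).
by rewrite -ephi; have /(congr1 (fun k => k x)) /= -> := morph_equivariant h.
Qed.

Lemma clock_addr (X : dynsys) m (phi c : X -> nat) : clock m phi ->
  locally_constant c -> (forall x, c (dmap x) = c x) ->
  clock m (fun x => phi x + c x).
Proof.
move=> [cphi ephi] cc ec; split=> [|x].
  exact: (locally_constant2 addn).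
by rewrite ec -addSn; apply: eq_modD.
Qed.

Lemma defect_invariant (X : dynsys) n (phi psi : X -> nat) : 0 < n ->
  clock n phi -> clock n psi -> forall x,
  defect n (phi (dmap x)) (psi (dmap x)) = defect n (phi x) (psi x).
Proof.
move=> n0 [_ ephi] [_ epsi] x; symmetry; apply: defect_uniq => //.
  by rewrite ltn_mod.
rewrite ephi -modnDml epsi modnDml addSn -addn1 -[in RHS]addn1.
by apply: eq_modD => //; exact: defectP.
Qed.

(** The difference phi - psi mod n is invariant, and its least representative
    may be added to psi modulo m without spoiling equivariance. *)
Lemma clock_lift (X : dynsys) n m (phi psi : X -> nat) : 0 < n -> n %| m ->
  clock n phi -> clock m psi ->
  exists2 chi : X -> nat, clock m chi & forall x, chi x = phi x %[mod n].
Proof.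
move=> n0 nm cphi cpsi.
exists (fun x => psi x + defect n (phi x) (psi x)); last first.
  by move=> x; exact: defectP.
apply: clock_addr => //.
  by apply: (locally_constant2 (defect n)); [case: cphi|case: cpsi].
exact: defect_invariant n0 cphi (clock_dvd nm cpsi).
Qed.

Lemma clock_glue (X : dynsys) a b (phi psi : X -> nat) : 0 < a -> 0 < b ->
  clock a phi -> clock b psi -> (forall x, phi x = psi x %[mod gcdn a b]) ->
  exists2 chi : X -> nat, clock (lcmn a b) chi &
    forall x, chi x = phi x %[mod a] /\ chi x = psi x %[mod b].
Proof.
move=> a0 b0 [cphi ephi] [cpsi epsi] agree.
have chiP x := chinese_lcmP a0 b0 (agree x).
exists (fun x => chinese_lcm a b (phi x) (psi x)) => [|x]; last exact: chiP.
split=> [|x]; first exact: (locally_constant2 (chinese_lcm a b)).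
have [fa fb] := chiP (dmap x); have [xa xb] := chiP x.
by apply: eq_mod_lcm; rewrite ?fa ?fb ?ephi ?epsi -addn1 -[in RHS]addn1;
  apply: eq_modD.
Qed.

(** The clock modulo b is first corrected to agree with the given one modulo
    gcd(a, b), after which the two can be glued. *)
Lemma clock_extend (X : dynsys) a b (phi psi : X -> nat) : 0 < a -> 0 < b ->
  clock a phi -> clock b psi ->
  exists2 chi : X -> nat, clock (lcmn a b) chi &
    forall x, chi x = phi x %[mod a].
Proof.
move=> a0 b0 cphi cpsi.
have g0 : 0 < gcdn a b by rewrite gcdn_gt0 a0.
have [psi' cpsi' agree] := clock_lift g0 (dvdn_gcdr a b)
  (clock_dvd (dvdn_gcdl a b) cphi) cpsi.
have [|chi cchi chiP] := clock_glue a0 b0 cphi cpsi'.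
  by move=> x; rewrite agree.
by exists chi => // x; case: (chiP x).
Qed.

(** * Periods *)

(** The clock of a partition is the index of the cell; conversely the cells are
    the fibres of the clock modulo m. *)
Lemma periodsP (X : dynsys) m :
  periods X m <-> 0 < m /\ exists phi : X -> nat, clock m phi.
Proof.
split=> [[m0 [W [tW cW oW fW lW]]]|[m0 [phi [cphi ephi]]]]; split=> //.
  have /choice[phi phiP] : forall x, exists i, i < m /\ W i x.
    move=> x; have : [set: X] x by [].
    by rewrite -cW => -[i im Wi]; exists i.
  have phi_uniq x i : i < m -> W i x -> phi x = i.
    move=> im Wi; have [pm Wp] := phiP x.
    by apply: (tW _ _ pm im); exists x.
  exists phi; split=> [x|x].
    have [pm Wp] := phiP x; have [oWp _] := oW _ pm.
    apply: filterS (open_nbhs_nbhs (conj oWp Wp)) => y; exact: phi_uniq.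
  have [pm Wp] := phiP x.
  have [lt|ge] := ltnP (phi x).+1 m.
    congr modn; apply: phi_uniq => //.
    by rewrite -(fW _ (_ : 0 < (phi x).+1 < m)) //; exists x.
  have pE : phi x = m.-1 by rewrite (@anti_leq m (phi x).+1) ?ge ?pm.
  rewrite pE prednK // modnn (@phi_uniq _ 0) ?mod0n //.
  by rewrite -lW -pE; exists x.
have [dinv [_ fK Kf]] := dynsys_homeo X.
pose W i := [set x : X | phi x = i %[mod m]].
have oW (P : set nat) : open [set x : X | P (phi x)].
  rewrite openE => x Px; apply: filterS (cphi x) => y /= yx.
  by rewrite /preimage /= yx.
have step i x : phi (dmap x) = i.+1 %[mod m] <-> phi x = i %[mod m].
  rewrite ephi -addn1 -[i.+1]addn1; split=> [/eqP|/eqP xi].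
    by rewrite eqn_modDr => /eqP.
  by apply/eqP; rewrite eqn_modDr.
have imW i : @dmap X @` W i = W i.+1.
  apply/seteqP; split=> [_ [x Wx <-]|y Wy]; first exact/step.
  by exists (dinv y); [apply/step; rewrite Kf|rewrite Kf].
exists W; split.
- move=> i j im jm [x []]; rewrite /W /= => ->.
  by rewrite !modn_small.
- apply/seteqP; split=> // x _.
  by exists (phi x %% m); rewrite /= ?ltn_mod // /W /= modn_mod.
- move=> i im; split; first exact: (oW [set k | k = i %[mod m]]).
  rewrite -openC; exact: (oW [set k | k <> i %[mod m]]).
- by move=> [|i] // _; exact: imW.
- rewrite imW prednK //; apply/seteqP; rewrite /W /= modnn mod0n.
  by split.
Qed.

Lemma periods1 (X : dynsys) : periods X 1.
Proof.
apply/periodsP; split=> //; exists (fun=> 0); split=> x; last by rewrite !modn1.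
exact: nearW.
Qed.

Lemma periods_lcm (X : dynsys) a b :
  periods X a -> periods X b -> periods X (lcmn a b).
Proof.
move=> /periodsP[a0 [phi cphi]] /periodsP[b0 [psi cpsi]].
apply/periodsP; rewrite lcmn_gt0 a0 b0; split=> //.
by have [chi cchi _] := clock_extend a0 b0 cphi cpsi; exists chi.
Qed.

Lemma periods_morphism (X Y : dynsys) (h : morphism X Y) :
  periods Y `<=` periods X.
Proof.
move=> m /periodsP[m0 [phi cphi]]; apply/periodsP; split=> //.
by exists (phi \o h); exact: clock_comp.
Qed.

(** * Ultranatural numbers *)

(** The finite lower bounds of a supremum determine it, which avoids separating
    bounded from unbounded sets in what follows. *)
Lemma enat_supP (K : set nat) k : K !=set0 ->
  enat_le (Some k) (enat_sup K) <-> exists2 j, K j & k <= j.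
Proof.
move=> K0; have above i : ~ ubound K i -> exists2 j, K j & i < j.
  move=> nub; apply: contrapT => /forall2NP nK; apply: nub => j Kj.
  by case: (nK j) => // /negP; rewrite -leqNgt.
rewrite /enat_sup; case: asboolP => [ubK|nubK]; last first.
  split=> // _; have [|j Kj kj] := above k.
    by move=> ubk; apply: nubK; exists k.
  by exists j => //; exact: ltnW.
have sK := nat_supremums_neq0 ubK.
split=> [ks|[j Kj kj]]; last first.
  exact: leq_trans kj (ge_supremum_Nmem 0 sK Kj).
have [_ lubK] : supremums K (supremum 0 K).
  rewrite /supremum; case: eqP => [K00|_].
    by case: K0 => i; rewrite K00.
  exact: (xgetPex 0 sK).
case: k ks => [|k ks]; first by case: K0 => i Ki _; exists i.
apply: above => ubk; have := lubK k ubk.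
by move: ks; rewrite /= => ks sk; have := leq_trans ks sk; rewrite ltnn.
Qed.

Lemma enat_leP (a b : enat) :
  (forall k, enat_le (Some k) a -> enat_le (Some k) b) -> enat_le a b.
Proof.
case: a b => [i|] [j|] //= ab; first exact: ab.
by have := ab j.+1 I; rewrite ltnn.
Qed.

Lemma enat_le_trans (a b c : enat) : enat_le a b -> enat_le b c -> enat_le a c.
Proof. by case: a b c => [a|] [b|] [c|] //; exact: leq_trans. Qed.

Lemma enat_le_anti (a b : enat) : enat_le a b -> enat_le b a -> a = b.
Proof.
case: a b => [a|] [b|] //= ab ba; congr Some; apply/eqP.
by rewrite eqn_leq ab.
Qed.

Lemma Phi_leP (S T : set nat) : S !=set0 -> T !=set0 ->
  ultra_le (Phi S) (Phi T) <->
  forall p k s, prime p -> S s -> p ^ k %| s -> exists2 t, T t & p ^ k %| t.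
Proof.
move=> [s0 Ss0] [t0 Tt0].
pose K U p := [set k | exists2 a, U a & p ^ k %| a].
have K0 U p u0 : U u0 -> K U p !=set0.
  by move=> Uu0; exists 0, u0; rewrite ?dvd1n.
split=> [leST p k s pr_p Ss pks|dom p].
  have: enat_le (Some k) (enat_sup (K S p)).
    by apply/(enat_supP k (K0 _ p _ Ss)); exists k => //; exists s.
  move/enat_le_trans/(_ (leST (exist _ p pr_p))).
  move/(enat_supP k (K0 _ p _ Tt0)) => [j [t Tt pjt] kj].
  by exists t => //; apply: dvdn_trans pjt; exact: dvdn_exp2l.
apply: enat_leP => k /(enat_supP k (K0 _ (sval p) _ Ss0))[j [s Ss pjs] kj].
apply/(enat_supP k (K0 _ (sval p) _ Tt0)).
have [t Tt pjt] := dom _ _ _ (svalP p) Ss pjs.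
by exists j => //; exists t.
Qed.

Lemma Phi_mono (S T : set nat) : S !=set0 -> T !=set0 ->
  (forall s, S s -> exists2 t, T t & s %| t) -> ultra_le (Phi S) (Phi T).
Proof.
move=> S0 T0 dom; apply/(Phi_leP S0 T0) => p k s _ /dom[t Tt st] pks.
by exists t => //; exact: dvdn_trans st.
Qed.

Lemma ultra_le_anti M N : ultra_le M N -> ultra_le N M -> M = N.
Proof.
by move=> MN NM; apply: functional_extensionality_dep => p; exact: enat_le_anti.
Qed.

(** Each prime power factor of s divides some element of T; the lcm of these
    finitely many elements is a multiple of s. *)
Lemma Phi_dvd (S T : set nat) s : T 1 ->
  (forall a b, T a -> T b -> T (lcmn a b)) ->
  ultra_le (Phi S) (Phi T) -> S s -> 0 < s -> exists2 t, T t & s %| t.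
Proof.
move=> T1 Tlcm leST Ss s0.
have [S0 T0] : S !=set0 /\ T !=set0 by split; [exists s|exists 1].
have /choice[t tP] : forall p : nat, exists t, T t /\ s`_p %| t.
  move=> p; have [ps|] := boolP (p \in \pi(s)); last first.
    by rewrite -p_part_eq1 => /eqP ->; exists 1.
  move: ps; rewrite mem_primes p_part => /andP[pr_p _].
  have [t Tt pt] := (Phi_leP S0 T0).1 leST p _ s pr_p Ss (pfactor_dvdnn p s).
  by exists t.
exists (\big[lcmn/1]_(p < s.+1) t p).
  by elim/big_ind : _ => // p _; case: (tP p).
apply/dvdn_partP => // p; rewrite mem_primes => /and3P[_ _ ps].
have ps1 : p < s.+1 by rewrite ltnS dvdn_leq.
apply: (biglcmn_sup (Ordinal ps1)) => //=; by case: (tP p).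
Qed.

Lemma Phi_periods_le (X Y : dynsys) (h : morphism X Y) :
  ultra_le (Phi (periods Y)) (Phi (periods X)).
Proof.
apply: Phi_mono; try by exists 1; exact: periods1.
by move=> m /(periods_morphism h) Xm; exists m.
Qed.

(** * Odometers *)

Lemma divseq_dvd (n : divseq) i j : i <= j -> n i %| n j.
Proof.
elim: j => [|j IHj]; first by rewrite leqn0 => /eqP ->.
rewrite leq_eqVlt => /predU1P[->//|]; rewrite ltnS => /IHj.
by move/dvdn_trans; apply; exact: dseq_dvd.
Qed.

Section Odometer.
Variable n : divseq.
Implicit Types a b : odo_space n.

Definition odo_val i a : nat := nat_of_ord (odo_coord a i : 'I_(n i).-1.+1).

Lemma odo_val_lt i a : odo_val i a < n i.
Proof.
apply: leq_trans (ltn_ord (odo_coord a i : 'I_(n i).-1.+1)) _.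
by rewrite prednK ?dseq_gt0.
Qed.

Lemma odo_val_red i a : odo_val i.+1 a %% n i = odo_val i a.
Proof.
by rewrite /odo_val -(odo_coord_red a i) /= modn_prednK ?dseq_gt0.
Qed.

Lemma odo_coordP i a b :
  odo_coord a i = odo_coord b i <-> odo_val i a = odo_val i b.
Proof. by split=> [ab|]; [rewrite /odo_val ab|exact: val_inj]. Qed.

Lemma odo_val_dvd i j a : i <= j -> odo_val j a %% n i = odo_val i a.
Proof.
elim: j => [|j IHj].
  by rewrite leqn0 => /eqP ->; rewrite modn_small ?odo_val_lt.
rewrite leq_eqVlt => /predU1P[->|]; first by rewrite modn_small ?odo_val_lt.
by rewrite ltnS => ij; rewrite -(IHj ij) -(odo_val_red j) modn_dvdm ?divseq_dvd.
Qed.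

Lemma odo_val_clock i : @clock (odometer n) (n i) (odo_val i).
Proof.
split=> [a|a].
  have ca : \forall b \near a, odo_coord b i = odo_coord a i.
    have H := odo_coord_continuous (discrete_set1 (odo_coord a i)).
    exact H.
  by apply: filterS ca => b; apply: (odo_coordP i b a).1.
by rewrite /odo_val /= !modn_prednK ?dseq_gt0 // modn_mod modnDmr addn1.
Qed.

(** The cylinders at a generate a filter converging to a: in the inverse limit
    topology it is enough to check each coordinate separately. *)
Lemma odo_cylinder a (U : set (odo_space n)) : nbhs a U ->
  exists i, forall b, odo_val i b = odo_val i a -> U b.
Proof.
pose F := filter_from [set: nat] (fun i => [set b | odo_val i b = odo_val i a]).
have FF : Filter F.
  apply: filter_from_filter => [|i j _ _]; first by exists 0.
  exists (maxn i j) => // b /= ab.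
  split; rewrite /=.
    by rewrite -(odo_val_dvd b (leq_maxl i j)) ab odo_val_dvd ?leq_maxl.
  by rewrite -(odo_val_dvd b (leq_maxr i j)) ab odo_val_dvd ?leq_maxr.
have Fa : set_val @ F --> set_val a.
  apply/cvg_sup => i B [_ [[C oC <-] /= Ca CB]].
  exists i => // b /odo_coordP ab; apply: CB => /=.
  by rewrite /= -/(odo_coord b i) ab.
move=> [_ [[W oW <-] /= Wa WU]].
have [i _ iW] := Fa _ (open_nbhs_nbhs (conj oW Wa)).
by exists i => b /iW Wb; exact: WU.
Qed.
End Odometer.

Lemma clock_iter (X : dynsys) m (phi : X -> nat) k x : clock m phi ->
  phi (iter k (@dmap X) x) = phi x + k %[mod m].
Proof.
move=> [_ ephi]; elim: k => [|k IHk]; first by rewrite addn0.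
by rewrite iterS ephi addnS -addn1 -[in RHS]addn1; apply: eq_modD.
Qed.

Lemma odo_orbit n (a b : odometer n) i :
  exists k, odo_val i (iter k (@dmap (odometer n)) a) = odo_val i b.
Proof.
exists (defect (n i) (odo_val i b) (odo_val i a)).
rewrite -[LHS](modn_small (odo_val_lt _ _)) -[RHS](modn_small (odo_val_lt _ _)).
by rewrite (clock_iter _ _ (odo_val_clock n i)) defectP ?dseq_gt0.
Qed.

(** Minimality: every orbit meets the cylinder around b where c is constant. *)
Lemma odo_invariant_constant n (c : odometer n -> nat) : locally_constant c ->
  (forall a, c (dmap a) = c a) -> forall a b, c a = c b.
Proof.
move=> cc ic a b; have [i ci] := odo_cylinder (cc b).
have [k /ci <-] := odo_orbit a b i.
by elim: k => //= k ->; rewrite ic.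
Qed.

Lemma morph_iter (X Y : dynsys) (h : morphism X Y) k x :
  h (iter k (@dmap X) x) = iter k (@dmap Y) (h x).
Proof.
elim: k => //= k <-.
by have /(congr1 (fun g => g (iter k (@dmap X) x))) := morph_equivariant h.
Qed.

(** The image is closed by compactness, and contains a dense orbit. *)
Lemma morphism_odometer_surj (X : dynsys) n (h : morphism X (odometer n)) b :
  exists x, h x = b.
Proof.
have cl : closed (range h).
  apply: compact_closed; first exact: odo_hausdorff.
  apply: continuous_compact; last exact: dynsys_compact.
  exact/continuous_subspaceT/morph_continuous.
have [x0 _] := dynsys_nonempty X.
suff [x _ <-] : range h b by exists x.
apply: cl => B /odo_cylinder[i iB].
have [k ki] := odo_orbit (h x0) b i.
exists (h (iter k (@dmap X) x0)); split; first by exists (iter k (@dmap X) x0).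
by apply: iB; rewrite morph_iter.
Qed.

(** The universal property of the odometer as an inverse limit of rotations. *)
Lemma odo_factor (X : dynsys) (n : divseq) (phi : nat -> X -> nat) :
  (forall i, clock (n i) (phi i)) ->
  (forall i x, phi i.+1 x = phi i x %[mod n i]) ->
  exists h : morphism X (odometer n),
    forall i x, odo_val i (h x) = phi i x %% n i.
Proof.
move=> cphi comp.
pose co (x : X) i : cyc (n i) := inZp (phi i x).
have co_red x i : cyc_red (n i) (co x i.+1) = co x i.
  apply: val_inj => /=; rewrite !prednK ?dseq_gt0 // modn_dvdm ?dseq_dvd //.
pose h (x : X) : odo_space n := odo_mk (co_red x).
have hE i x : odo_val i (h x) = phi i x %% n i.
  by rewrite /odo_val /= modn_prednK ?dseq_gt0.
have ch : continuous h.
  apply: odo_continuous => i x; apply: cvg_near_cst.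
  by apply: filterS ((cphi i).1 x) => y xy; apply/odo_coordP; rewrite !hE xy.
have eh : h \o @dmap X = @odo_map n \o h.
  apply: functional_extensionality_dep => x; apply: odo_eq => i.
  apply/odo_coordP; rewrite /= hE (cphi i).2.
  have /= := (odo_val_clock n i).2 (h x).
  rewrite modn_small ?odo_val_lt // => ->.
  by rewrite hE -addn1 -[in RHS]addn1 modnDml.
by exists (@Morphism X (odometer n) h ch eh).
Qed.

(** * Enlarging and splitting morphisms to odometers *)

(** The clocks psi_i of A, pulled back along p, agree with the coordinates of
    the odometer up to constants d_i; the corrected clocks psi_i + d_i define
    the left inverse. Their compatibility is checked on the odometer, which is where
    surjectivity of p is needed. *)
Lemma odo_retraction (n : divseq) (A : dynsys) (p : morphism (odometer n) A) :
  (forall y, exists a, p a = y) -> (forall i, periods A (n i)) ->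
  exists r : morphism A (odometer n), forall a, r (p a) = a.
Proof.
move=> p_surj perA.
have /choice[psi cpsi] : forall i, exists psi : A -> nat, clock (n i) psi.
  by move=> i; have /periodsP[_] := perA i.
have [a0 _] := dynsys_nonempty (odometer n).
pose d i (a : odometer n) := defect (n i) (odo_val i a) (psi i (p a)).
have d_const i a : d i a = d i a0.
  apply: odo_invariant_constant.
    apply: (locally_constant2 (defect (n i))).
      exact: (odo_val_clock n i).1.
    by have [] := clock_comp p (cpsi i).
  apply: defect_invariant; rewrite ?dseq_gt0 //; first exact: odo_val_clock.
  exact: clock_comp.
have dP i a : psi i (p a) + d i a0 = odo_val i a %[mod n i].
  by rewrite -(d_const i a); apply: defectP; exact: dseq_gt0.
have [||r rP] := @odo_factor A n (fun i y => psi i y + d i a0).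
- by move=> i; apply: clock_addr => // y; exact: nearW.
- move=> i y; have [a <-] := p_surj y.
  rewrite (eq_mod_dvd (dseq_dvd n i) (dP i.+1 a)) dP -(odo_val_red i).
  by rewrite modn_mod.
exists r => a; apply: odo_eq => i; apply/odo_coordP.
by rewrite rP dP modn_small ?odo_val_lt.
Qed.

Lemma gcdn_stabilizes (n : divseq) l : 0 < l ->
  exists j0, forall j, j0 <= j -> gcdn (n j) l = gcdn (n j0) l.
Proof.
move=> l0; pose P d := `[< exists j, gcdn (n j) l = d >].
have exP : exists d, P d by exists (gcdn (n 0) l); apply/asboolP; exists 0.
have ubP d : P d -> d <= l.
  by move=> /asboolP[j <-]; rewrite dvdn_leq ?dvdn_gcdr.
have [d /asboolP[j0 j0d] dmax] := ex_maxnP exP ubP.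
exists j0 => j jj; apply/eqP; rewrite eqn_leq; apply/andP; split.
  by rewrite j0d; apply: dmax; apply/asboolP; exists j.
apply: dvdn_leq; first by rewrite gcdn_gt0 l0 orbT.
by rewrite dvdn_gcd dvdn_gcdr andbT (dvdn_trans (dvdn_gcdl _ _)) ?divseq_dvd.
Qed.

Lemma indexed_dependent_choice (T : Type) (P : nat -> T -> Prop)
    (R : nat -> T -> T -> Prop) x0 : P 0 x0 ->
  (forall k x, P k x -> exists2 y, P k.+1 y & R k x y) ->
  exists u : nat -> T, forall k, P k (u k) /\ R k (u k) (u k.+1).
Proof.
move=> Px0 step.
have /choice[g gP] : forall p : nat * T, exists y,
    P p.1 p.2 -> P p.1.+1 y /\ R p.1 p.2 y.
  move=> [k x]; have [/step[y Py Rxy]|nP] := EM (P k x); first by exists y.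
  by exists x.
pose u := fix u k := if k is k'.+1 then g (k', u k') else x0.
have Pu k : P k (u k) by elim: k => //= k Pk; case: (gP (k, u k) Pk).
by exists u => k; split=> //; case: (gP (k, u k) (Pu k)).
Qed.

Definition period_lcm (X : dynsys) k :=
  \big[lcmn/1]_(i < k.+1 | `[< periods X i >]) i.

Lemma periods_period_lcm (X : dynsys) k : periods X (period_lcm X k).
Proof.
rewrite /period_lcm; elim/big_ind: _ => [|a b|i /asboolP//].
  exact: periods1.
exact: periods_lcm.
Qed.

Lemma dvdn_period_lcm (X : dynsys) m k :
  periods X m -> m <= k -> m %| period_lcm X k.
Proof.
move=> Xm mk; have mk1 : m < k.+1 by [].
by apply: (biglcmn_sup (Ordinal mk1)) => //; exact/asboolP.
Qed.

Lemma period_lcm_dvd (X : dynsys) k : period_lcm X k %| period_lcm X k.+1.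
Proof.
apply/dvdn_biglcmP => i /asboolP Xi; apply: dvdn_period_lcm => //.
exact: ltnW.
Qed.

(** Enlarging the moduli n_j by the periods of X must not create congruences
    with moduli n_i still to come. This is why the k-th new modulus is the lcm of
    n_(J k) and L k for an index J k beyond which the n_j share no further
    factor with L k. *)
Lemma odometer_enlarge (X : dynsys) n (h : morphism X (odometer n)) :
  exists (M : divseq) (h' : morphism X (odometer M))
    (s : morphism (odometer M) (odometer n)),
  h = morph_comp s h' /\ Phi (periods (odometer M)) = Phi (periods X).
Proof.
pose L := period_lcm X.
have L0 k : 0 < L k by have [] := periods_period_lcm X k.
have /choice[j0 j0P] := fun k => gcdn_stabilizes n (L0 k).
(* Summing makes J increasing and at least the identity, while keeping
   J k >= j0 k. *)
pose J k := \sum_(i < k.+1) (j0 i).+1.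
have JS k : J k.+1 = J k + (j0 k.+1).+1 by rewrite /J big_ord_recr.
have Jstable k j : J k <= j -> gcdn (n j) (L k) = gcdn (n (J k)) (L k).
  have j0J : j0 k <= J k.
    by rewrite /J big_ord_recr /= addnS ltnW ?ltnS ?leq_addl.
  by move=> Jj; rewrite !j0P ?(leq_trans j0J).
have Jmono k : J k <= J k.+1 by rewrite JS leq_addr.
have Jge k : k <= J k.
  elim: k => // k IHk; rewrite JS addnS ltnS; exact: leq_trans (leq_addr _ _).
pose m k := lcmn (n (J k)) (L k).
have m0 k : 0 < m k by rewrite lcmn_gt0 dseq_gt0 L0.
have m_dvd k : m k %| m k.+1.
  rewrite dvdn_lcm (dvdn_trans (divseq_dvd n (Jmono k)) (dvdn_lcml _ _)).
  exact: dvdn_trans (period_lcm_dvd X k) (dvdn_lcmr _ _).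
have phiL k : exists phi : X -> nat, clock (L k) phi.
  by have /periodsP[] := periods_period_lcm X k.
pose phi j x := odo_val j (h x).
have cphi j : clock (n j) (phi j).
  exact: (clock_comp h (odo_val_clock n j)).
pose P k (chi : X -> nat) :=
  clock (m k) chi /\ forall x, chi x = phi (J k) x %[mod n (J k)].
pose R k (chi chi' : X -> nat) := forall x, chi' x = chi x %[mod m k].
have [chi0 Pchi0] : exists chi, P 0 chi.
  have [psi cpsi] := phiL 0.
  have [chi cchi echi] := clock_extend (dseq_gt0 n (J 0)) (L0 0) (cphi _) cpsi.
  by exists chi.
have [chi chiP] : exists chi : nat -> X -> nat, forall k,
    P k (chi k) /\ R k (chi k) (chi k.+1).
  apply: (indexed_dependent_choice Pchi0) => k chi [cchi echi].
  have gE : gcdn (m k) (n (J k.+1)) = n (J k).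
    apply: gcdn_lcm_stable; first exact: divseq_dvd.
    exact: Jstable.
  have [|psi cpsi epsi] :=
    clock_glue (m0 k) (dseq_gt0 n (J k.+1)) cchi (cphi _).
    by move=> x; rewrite gE echi /phi -(odo_val_dvd (h x) (Jmono k)) modn_mod.
  have mn0 : 0 < lcmn (m k) (n (J k.+1)) by rewrite lcmn_gt0 m0 dseq_gt0.
  have [xi cxi] := phiL k.+1.
  have [chi' cchi' echi'] := clock_extend mn0 (L0 k.+1) cpsi cxi.
  exists chi' => [|x]; last first.
    by rewrite (eq_mod_dvd (dvdn_lcml _ _) (echi' x)); case: (epsi x).
  split=> [|x]; last first.
    by rewrite (eq_mod_dvd (dvdn_lcmr _ _) (echi' x)); case: (epsi x).
  apply: clock_dvd cchi'; rewrite dvdn_lcm dvdn_lcmr andbT.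
  exact: dvdn_trans (dvdn_lcmr _ _) (dvdn_lcml _ _).
pose M := Divseq m0 m_dvd.
have nM j : n j %| M j.
  exact: dvdn_trans (divseq_dvd n (Jge j)) (dvdn_lcml _ _).
have [h' h'P] : exists h' : morphism X (odometer M), forall k x,
    odo_val k (h' x) = chi k x %% M k.
  by apply: odo_factor => k; have [[]] := chiP k.
have [||s sP] := @odo_factor (odometer M) n (fun j => odo_val j).
- by move=> j; exact: clock_dvd (nM j) (odo_val_clock M j).
- by move=> j a; rewrite -(odo_val_red j a) modn_dvdm ?nM.
exists M, h', s; split.
  apply/morphism_eq/functional_extensionality_dep => x.
  apply: odo_eq => j; apply/odo_coordP => /=.
  rewrite sP h'P modn_dvdm ?nM //; have [[_ echi] _] := chiP j.
  rewrite (eq_mod_dvd (divseq_dvd n (Jge j)) (echi x)).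
  by rewrite [RHS](odo_val_dvd (h x) (Jge j)).
apply: ultra_le_anti; first exact: Phi_periods_le h'.
apply: Phi_mono; try by exists 1; exact: periods1.
move=> p Xp; exists (M p).
  apply/periodsP; split; first exact: m0.
  by exists (odo_val p); exact: odo_val_clock.
exact: dvdn_trans (dvdn_period_lcm Xp (leqnn p)) (dvdn_lcmr _ _).
Qed.

(** * The category of morphisms from X to odometers *)

Lemma isomorphic_trans (C : category) (x y z : C) :
  isomorphic x y -> isomorphic y z -> isomorphic x z.
Proof.
move=> [u [v [vu uv]]] [u' [v' [vu' uv']]].
exists (compm u' u), (compm v v'); split.
  by rewrite compm_assoc -(compm_assoc v) vu' compm_idr.
by rewrite compm_assoc -(compm_assoc u') uv compm_idr.
Qed.

Lemma sig_eq (T : Type) (P : T -> Prop) (x y : {z | P z}) :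
  sval x = sval y -> x = y.
Proof.
case: x y => [x Px] [y Py] /= xy; case: _ / xy Py => Py.
by rewrite (Prop_irrelevance Px Py).
Qed.

Lemma morphism_surj (X D : dynsys) n (h : morphism X D) :
  @isomorphic K0 D (odometer n) -> forall y, exists x, h x = y.
Proof.
move=> [u [v [vu _]]] y.
have [x hx] := morphism_odometer_surj (morph_comp u h) (u y).
exists x; have vK z : v (u z) = z.
  by have /(congr1 (fun g : morphism D D => g z)) := vu.
by rewrite -[LHS]vK -[RHS]vK -hx.
Qed.

Section CategoryB.
Variable X : dynsys.

Lemma system_odometer (D : catAX X) :
  exists n, @isomorphic K0 (system D) (odometer n).
Proof. exact: (proj2_sig (sval D)). Qed.

Lemma mapB_surj (o : objB X) y : exists x, mapB o x = y.
Proof.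
have [n isoD] := system_odometer (targetB o); exact: morphism_surj isoD y.
Qed.

(** Both composites of two opposite arrows fix the image of X, which is
    everything. *)
Lemma homB_retraction (o1 o2 : catB X) (u : hom o1 o2)
  (v : hom o2 o1) : compm v u = idm o1.
Proof.
apply: homB_eq; apply: morphism_eq; apply: functional_extensionality_dep => y.
have [x <-] := mapB_surj y.
have /(congr1 (fun g : morphism _ _ => g x)) /= vx := homB_comm v.
have /(congr1 (fun g : morphism _ _ => g x)) /= ux := homB_comm u.
by rewrite /= -ux -vx.
Qed.

Lemma homB_isomorphic (o1 o2 : catB X) (u : hom o1 o2) (v : hom o2 o1) :
  isomorphic o1 o2.
Proof. by exists u, v; split; exact: homB_retraction. Qed.

Lemma isomorphic_periods (o1 o2 : catB X) : isomorphic o1 o2 ->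
  periods (system (targetB o1)) = periods (system (targetB o2)).
Proof.
move=> [u [v _]]; apply/seteqP; split.
  exact: periods_morphism (homB_fun v).
exact: periods_morphism (homB_fun u).
Qed.

Variables (A0 : catAX X -> Prop) (hA0 : skeleton A0).
Variables (B0' : catB' A0 -> Prop) (hB0' : skeleton B0').

(** Two successive choices: a representative of the target in [A0], to which the
    morphism from X is transported, then one of the resulting pair in [B0']. *)
Lemma representative (o : catB X) :
  exists z : catB0' B0', isomorphic o (underlyingB z).
Proof.
have [y [[A0y [u [v [vu uv]]]] _]] := hA0 (targetB o).
pose o1 : catB X := @ObjB X y (morph_comp (u : morphism _ _) (mapB o)).
have o_o1 : isomorphic o o1.
  have cv : mapB o = morph_comp (v : morphism _ _) (mapB o1).
    rewrite /= morph_compA.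
    by rewrite (vu : morph_comp _ _ = morph_id _) morph_comp_idl.
  exact: (@homB_isomorphic o o1 (@HomB X o o1 u erefl) (@HomB X o1 o v cv)).
have [z [[B0z isoz] _]] := hB0' (exist _ o1 A0y : catB' A0).
exists (exist _ z B0z); exact: isomorphic_trans o_o1 isoz.
Qed.

Lemma isomorphic_eq (o1 o2 : catB0' B0') :
  isomorphic (underlyingB o1) (underlyingB o2) -> o1 = o2.
Proof.
move=> iso12; apply: sig_eq.
have [z [_ uniq]] := hB0' (sval o1).
rewrite -(uniq (sval o1)); last first.
  split; first exact: svalP.
  by exists (idm _), (idm _); rewrite compm_idl.
by apply: uniq; split; first exact: svalP.
Qed.

Lemma preceq_order : Relation_Definitions.order (catB0' B0') (@preceq X A0 B0').
Proof.
split.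
- by move=> o; constructor; exact: idm.
- by move=> o1 o2 o3 [u] [v]; constructor; exact: compm u v.
- move=> o1 o2 [u] [v]; apply: isomorphic_eq; exact: homB_isomorphic v u.
Qed.

Lemma majorant (o : catB0' B0') : exists o' : catB0' B0',
  preceq o o' /\ Phi (periods (phase o')) = Phi (periods X).
Proof.
pose h := mapB (underlyingB o).
have [n [u [v [vu _]]]] := system_odometer (targetB (underlyingB o)).
have [M [h' [s [hs PhiM]]]] :=
  odometer_enlarge (morph_comp (u : morphism _ _) h).
have odoM : exists n, @isomorphic K0 (odometer M) (odometer n).
  by exists M, (morph_id _), (morph_id _); split; exact: morphism_eq.
have leM : ultra_le (Phi (periods (odometer M))) (Phi (periods X)).
  exact: Phi_periods_le h'.
pose D : catAX X := exist _ (exist _ (odometer M : K0) odoM : Defs.catA) leM.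
pose o1 : catB X := @ObjB X D h'.
pose vs := morph_comp (v : morphism _ _) s.
have c1 : mapB (underlyingB o) = morph_comp vs (mapB o1).
  rewrite /vs -morph_compA -hs morph_compA.
  by rewrite (vu : morph_comp _ _ = morph_id _) morph_comp_idl.
pose w : hom o1 (underlyingB o) :=
  @HomB X o1 (underlyingB o) vs c1.
have [z isoz] := representative o1; exists z; split.
  by have [_ [t _]] := isoz; constructor; exact: compm w t.
by rewrite /phase -(isomorphic_periods isoz).
Qed.

Lemma maximalP (o : catB0' B0') :
  maximal o <-> Phi (periods (phase o)) = Phi (periods X).
Proof.
split=> [maxo|PhiE o' [p]].
  by have [o' [/maxo -> ]] := majorant o.
apply: isomorphic_eq.
have [n [u [v [vu uv]]]] := system_odometer (targetB (underlyingB o')).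
pose q := morph_comp (homB_fun p : morphism _ _) (v : morphism _ _).
have q_surj y : exists a, q a = y.
  have [m isom] := system_odometer (targetB (underlyingB o)).
  exact: morphism_surj isom y.
have perA i : periods (phase o) (n i).
  have Xn : periods (phase o') (n i).
    apply: (periods_morphism (u : morphism _ _)).
    apply/periodsP; rewrite dseq_gt0; split=> //.
    by exists (odo_val i); exact: odo_val_clock.
  have le_o : ultra_le (Phi (periods (phase o'))) (Phi (periods (phase o))).
    by rewrite PhiE; exact: (proj2_sig (targetB (underlyingB o'))).
  have [t /periodsP[_ [psi cpsi]] nt] :=
    Phi_dvd (periods1 _) (@periods_lcm _) le_o Xn (dseq_gt0 n i).
  apply/periodsP; rewrite dseq_gt0; split=> //.
  by exists psi; exact: clock_dvd cpsi.
have [r rq] := odo_retraction q_surj perA.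
pose vr := morph_comp (v : morphism _ _) r.
have c : mapB (underlyingB o') = morph_comp vr (mapB (underlyingB o)).
  rewrite (homB_comm p); apply: morphism_eq.
  apply: functional_extensionality_dep => x.
  have vu' y : v (u y) = y.
    by have /(congr1 (fun g : morphism _ _ => g y)) := vu.
  rewrite /= -[X in r X](_ : q (u (mapB (underlyingB o') x)) = _).
    by rewrite rq vu'.
  by rewrite /q /= vu'.
exact: homB_isomorphic p (@HomB X (underlyingB o) (underlyingB o') vr c).
Qed.
End CategoryB.

Theorem proposition4p3 (X : dynsys)
    (A0 : catAX X -> Prop) (hA0 : skeleton A0)
    (B0' : catB' A0 -> Prop) (hB0' : skeleton B0') :
  Relation_Definitions.order (catB0' B0') (@preceq X A0 B0')
  /\ (forall o : catB0' B0', exists o' : catB0' B0',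
        preceq o o' /\ Phi (periods (phase o')) = Phi (periods X))
  /\ (forall o : catB0' B0',
        maximal o <-> Phi (periods (phase o)) = Phi (periods X)).
Proof.
split; first exact: preceq_order.
by split=> o; [exact: majorant|exact: maximalP].
Qed.
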